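(* If the continuum $\mathfrak{c} = 2^{\aleph_0}$ is a regular cardinal, then there is a base matrix of height $\mathfrak{c}$.
   Context: For $A,B\subseteq\omega$, write $A\subseteq^* B$ if $A\setminus B$ is finite. A mad family is a maximal (under inclusion) family of infinite subsets of $\omega$ whose members are pairwise almost disjoint (have finite intersection). A family $\mathcal{A}$ refines a family $\mathcal{B}$ if for every $A\in\mathcal{A}$ there is $B\in\mathcal{B}$ with $A\subseteq^* B$. A distributivity matrix of height $\vartheta$ (an ordinal) is a collection $\{\mathcal{A}_\gamma:\gamma<\vartheta\}$ of mad families such that $\mathcal{A}_\delta$ refines $\mathcal{A}_\gamma$ whenever $\gamma\le\delta<\vartheta$, and there is no mad family refining all the $\mathcal{A}_\gamma$. It is a base matrix if in addition $\bigcup_{\gamma<\vartheta}\mathcal{A}_\gamma$ is dense in $\mathcal{P}(\omega)/\mathrm{fin}$, i.e. for every infinite $B\subseteq\omega$ there are $\gamma<\vartheta$ and $A\in\mathcal{A}_\gamma$ with $A\subseteq^* B$. *)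

(* Defs.v *)
From mathcomp Require Import all_boot.
From mathcomp Require Import boolp wochoice classical_sets functions cardinality.

Set Implicit Arguments.
Unset Strict Implicit.
Unset Printing Implicit Defensive.

Local Open Scope classical_set_scope.
Local Open Scope card_scope.

Definition almost_subset (A B : set nat) : Prop := finite_set (A `\` B).

Definition ad_family (F : set (set nat)) : Prop :=
  (forall A, F A -> infinite_set A) /\
  (forall A B, F A -> F B -> A <> B -> finite_set (A `&` B)).

Definition mad_family (F : set (set nat)) : Prop :=
  ad_family F /\ (forall G, ad_family G -> F `<=` G -> G = F).

Definition refines (F G : set (set nat)) : Prop :=
  forall A, F A -> exists2 B, G B & almost_subset A B.

(* An ordinal is given as a well-ordered type (T, le), with le the reflexive
   order; the elements of T are the smaller ordinals. *)

Definition distributivity_matrix (T : Type) (le : rel T)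
    (M : T -> set (set nat)) : Prop :=
  [/\ forall g, mad_family (M g),
      forall g d, le g d -> refines (M d) (M g) &
      ~ exists2 F, mad_family F & forall g, refines F (M g)].

Definition base_matrix (T : Type) (le : rel T)
    (M : T -> set (set nat)) : Prop :=
  distributivity_matrix le M /\
  forall B : set nat, infinite_set B ->
    exists g, exists2 A, M g A & almost_subset A B.

Definition init_segment (T : Type) (le : rel T) (x : T) : set T :=
  [set y | le y x /\ y <> x].

(* (T, le) has the order type of a cardinal, i.e. of an initial ordinal. *)
Definition cardinal_order (T : Type) (le : rel T) : Prop :=
  well_order le /\ (forall x, ~ ([set: T] #<= init_segment le x)).

Definition continuum_order (T : Type) (le : rel T) : Prop :=
  cardinal_order le /\ [set: T] #= [set: set nat].

Definition cofinal_subset (T : Type) (le : rel T) (X : set T) : Prop :=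
  forall x, exists2 y, X y & le x y.

(* An infinite cardinal equal to its cofinality, the latter being the least
   cardinality of a cofinal subset. *)
Definition regular_cardinal (T : Type) (le : rel T) : Prop :=
  [/\ cardinal_order le, infinite_set [set: T] &
      forall X, cofinal_subset le X -> X #= [set: T]].

Lemma continuum_order_exists :
  exists (T : Type) (le : rel T), continuum_order le.
Proof.
have [R wR] := well_ordering_principle (set nat : eqType).
have [h|] := pselect (forall x, ~ ([set: set nat] #<= init_segment R x)).
  by exists (set nat), R; split; [split|exact: card_eqxx].
move=> /existsNP[x0 /contrapT hx0].
have [|x [[xP xmin] _]] :=
    wR (fun x => `[< [set: set nat] #<= init_segment R x >]).
  by exists x0; apply/asboolP.
have {}xP := asboolW xP.
pose T := set_type (init_segment R x).
pose le : rel T := fun a b => R (val a) (val b).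
have valK : injective (val : T -> set nat) by exact: val_inj.
have Ranti : antisymmetric R.
  move=> a b /andP[Rab Rba].
  have [|z [_ zU]] := wR (fun c => `[< c = a \/ c = b >]).
    by exists a; apply/asboolP; left.
  have refl c : R c c.
    have [|w [[wc wl] _]] := wR (fun d => `[< d = c >]).
      by exists c; apply/asboolP.
    by have := asboolW wc => <-; exact: wl.
  have zE c : c = a \/ c = b -> z = c.
    move=> hc; apply: zU; split; first exact/asboolP.
    by move=> e /asboolW[]->; case: hc => ->.
  by rewrite -(zE a (or_introl erefl)) -(zE b (or_intror erefl)).
have cT : [set: T] #= [set: set nat].
  have -> : ([set: T] #= [set: set nat]) = (init_segment R x #= [set: set nat]).
    apply: card_eql.
    rewrite card_eq_sym.
    have <- : (val : T -> set nat) @` [set: T] = init_segment R x.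
      apply/seteqP; split => [_ [a _ <-]|a ha]; first exact: set_valP.
      by exists (SigSub (mem_set ha)).
    by apply: inj_card_eq => a b _ _; exact: valK.
  by rewrite card_eq_le card_leT.
exists T, le; split=> //; split.
  apply: antisymmetric_well_order => [a b /Ranti/valK//|A [a Aa]].
  have [|_ [[/asboolW[b Ab <-] bm] _]] :=
      wR (fun y => `[< exists2 b : T, b \in A & val b = y >]).
    by exists (val a); apply/asboolP; exists a.
  by exists b; split=> // c Ac; apply: bm; apply/asboolP; exists c.
move=> y hy.
have [Ryx nyx] : init_segment R x (val y) by exact: set_valP.
apply: nyx; apply: Ranti; rewrite Ryx /=; apply: xmin; apply/asboolP.
rewrite -(card_le_eql cT); apply: card_le_trans hy _.
rewrite -(card_le_eql (A := val @` init_segment le y)); last first.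
  by apply: inj_card_eq => a b _ _; exact: valK.
apply: subset_card_le => _ [a [lay nay] <-]; split=> //.
by move/valK.
Qed.

(* Main.v *)
Require Import Defs.
From mathcomp Require Import all_boot.
From mathcomp Require Import boolp wochoice classical_sets functions cardinality.

(** A matrix of mad families is built by recursion on [x], handling the infinite
    set number [x] at stage [x] by putting one of its subsets into the family
    [M x].  A refining matrix with dense union has no common refinement, so only
    the existence of [M x] is at stake: the sets almost contained in a member of
    each earlier family must be dense.  To ensure this, at every stage at most
    one set is given up among those that belong to all families from some earlier
    stage on.  If the cofinality of [x] is countable, density follows by
    pseudo-intersections.  Otherwise, if an infinite set [X] has no subset as
    required, a binary tree of splittings of [X] yields [2 ^ aleph_0] members of
    one earlier family meeting [X]; fewer than continuum many of these are given
    up before [x], and any other one meets [X] in a set as required. *)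

Set Implicit Arguments.
Unset Strict Implicit.
Unset Printing Implicit Defensive.

Local Open Scope classical_set_scope.
Local Open Scope card_scope.

(** * Almost inclusion and pseudo-intersections *)

Section AlmostSubset.
Implicit Types A B C X Y Z : set nat.

Lemma subset_almost A B : A `<=` B -> almost_subset A B.
Proof. by rewrite -setD_eq0 /almost_subset => ->; exact: finite_set0. Qed.

Lemma almost_subIsetl A B : almost_subset (A `&` B) A.
Proof. by apply: subset_almost; exact: subIsetl. Qed.

Lemma almost_subIsetr A B : almost_subset (A `&` B) B.
Proof. by apply: subset_almost; exact: subIsetr. Qed.

Lemma almost_subset_trans A B C :
  almost_subset A B -> almost_subset B C -> almost_subset A C.
Proof.
move=> AB BC; apply: (@sub_finite_set _ _ ((A `\` B) `|` (B `\` C))).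
  by move=> n [An Cn]; have [Bn|Bn] := pselect (B n); [right|left].
by rewrite finite_setU.
Qed.

Lemma infinite_almost_subsetI Z B C : infinite_set Z ->
  almost_subset Z B -> almost_subset Z C -> infinite_set (B `&` C).
Proof.
move=> Zinf ZB ZC BC; apply: Zinf.
apply: (@sub_finite_set _ _ ((Z `\` B) `|` (Z `\` C) `|` (B `&` C))).
  move=> n Zn; have [Bn|Bn] := pselect (B n); last by left; left.
  by have [Cn|Cn] := pselect (C n); [right|left; right].
by rewrite !finite_setU.
Qed.

Lemma infinite_set_unbounded A m : infinite_set A -> exists2 k, A k & m <= k.
Proof.
move=> Ainf; apply: contrapT => bA; apply: Ainf.
apply: (@sub_finite_set _ _ `I_m); last exact: finite_II.
by move=> k Ak /=; rewrite ltnNge; apply/negP => mk; apply: bA; exists k.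
Qed.

(** List infinitely many elements of [B] without repetition: the even-indexed ones form [C], the
    odd-indexed ones stay outside. *)
Lemma infinite_coinfinite_subset B : infinite_set B ->
  exists2 C, C `<=` B & infinite_set C /\ infinite_set (B `\` C).
Proof.
move=> /infiniteP/pcard_leP[f].
have f_inj : injective f by move=> m n; apply: inj; rewrite in_setE.
have range_inf (g : nat -> nat) : injective g -> infinite_set (range (f \o g)).
  move=> g_inj; apply/infiniteP.
  by rewrite (card_le_eqr (inj_card_eq (in2W (inj_comp f_inj g_inj)))) card_lexx.
exists (range (f \o double)).
  by move=> _ [n _ <-]; exact: funS.
split; first exact: range_inf double_inj.
have /range_inf : injective (fun n => n.*2.+1) by move=> m n [/double_inj].
apply: sub_infinite_set => _ [n _ <-]; split; first exact: funS.
by move=> [m _ /f_inj/(congr1 odd)]; rewrite /= !odd_double.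
Qed.

(** Diagonalisation: [z n] is chosen in [Y n] with [z] strictly increasing, so only terms of index
    below [n] can lie outside [Y n]. *)
Lemma pseudo_intersection (Y : nat -> set nat) :
  (forall n, infinite_set (Y n)) -> (forall n, Y n.+1 `<=` Y n) ->
  exists2 Z, infinite_set Z & Z `<=` Y 0 /\ forall n, almost_subset Z (Y n).
Proof.
move=> Yinf Ydec.
have Ymono m n : m <= n -> Y n `<=` Y m.
  move=> /subnK <-; elim: (n - m) => [//|k IH].
  by rewrite addSn; exact: subset_trans (Ydec _) IH.
have /choice[g gP] (p : nat * nat) : exists k, Y p.1 k /\ p.2 <= k.
  by have [k Yk pk] := infinite_set_unbounded p.2 (Yinf p.1); exists k.
pose z := fix z n := if n is k.+1 then g (n, (z k).+1) else g (0, 0).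
have zY n : Y n (z n) by case: n => [|n]; exact: (gP (_, _)).1.
have zS n : z n < z n.+1 by exact: (gP (_, _)).2.
have zge n : n <= z n by elim: n => [//|n IH]; exact: leq_ltn_trans (zS n).
exists [set z n | n in [set: nat]]; [|split].
- move=> /finite_seqP[s sE].
  have sP n : z n \in s.
    by have : [set` s] (z n) by rewrite -sE; exists n.
  pose m := \max_(i <- s) i.
  have : z m.+1 <= m by apply: leq_bigmax_seq (sP _) _.
  by rewrite leqNgt zge.
- by move=> _ [n _ <-]; exact: (Ymono 0 n).
- move=> n; apply: (@sub_finite_set _ _ (z @` `I_n)).
    move=> _ [[k _ <-] nYk]; exists k => //=; rewrite ltnNge.
    by apply/negP => /Ymono nk; apply: nYk; exact: nk.
  by apply: finite_image; exact: finite_II.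
Qed.

End AlmostSubset.

(** * Mad families and their extension *)

Section MadFamilies.
Implicit Types (A B X Y : set nat) (F N D : set (set nat)).

Lemma ad_family_eq F A B : ad_family F -> F A -> F B ->
  infinite_set (A `&` B) -> A = B.
Proof. by move=> [_ adF] FA FB ABinf; apply: contrapT => /(adF _ _ FA FB). Qed.

Lemma ad_family_setU1 F Y : ad_family F -> infinite_set Y ->
  (forall A, F A -> A <> Y -> finite_set (A `&` Y)) -> ad_family (Y |` F).
Proof.
move=> [Finf adF] Yinf FY; split=> [A [->//|/Finf//]|A B].
move=> [->|FA] [->|FB] //; [|exact: FY|exact: adF].
by rewrite setIC => /nesym; exact: FY.
Qed.

Lemma mad_family_meets F X : mad_family F -> infinite_set X ->
  exists2 A, F A & infinite_set (X `&` A).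
Proof.
move=> [adF maxF] Xinf; apply: contrapT => noA.
have XF A : F A -> finite_set (A `&` X).
  by move=> FA; apply: contrapT => AX; apply: noA; exists A; rewrite // setIC.
have FX : F X.
  rewrite -(maxF (X |` F)); [by left| |by move=> A; right].
  by apply: ad_family_setU1 => // A /XF.
by apply: Xinf; rewrite -(setIid X); exact: XF.
Qed.

Lemma meets_mad_family F : ad_family F ->
  (forall X, infinite_set X -> exists2 A, F A & infinite_set (X `&` A)) ->
  mad_family F.
Proof.
move=> adF meetF; split=> // G adG FG; apply/seteqP; split=> // X GX.
have [A FA XA] := meetF _ (adG.1 _ GX).
by rewrite (ad_family_eq adG GX (FG _ FA) XA).
Qed.

(** If the part of [X] outside [A] were infinite, it would meet some member of [F] in an infinite
    set; that member could only be [A], which is disjoint from this part. *)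
Lemma mad_family_almost_subset F X A : mad_family F -> F A ->
  (forall B, F B -> infinite_set (X `&` B) -> B = A) -> almost_subset X A.
Proof.
move=> madF FA uA; apply: contrapT => XAinf.
have [B FB XAB] := mad_family_meets madF XAinf.
have BA : B = A by apply: uA => //; apply: sub_infinite_set XAB => n [[]].
by apply: XAB; rewrite BA setDE -setIA setICl setI0; exact: finite_set0.
Qed.

Lemma extend_to_mad_family D F :
  (forall X, infinite_set X -> exists2 Y, D Y & Y `<=` X) ->
  (forall Y, D Y -> infinite_set Y) ->
  F `<=` D -> ad_family F ->
  exists N, [/\ mad_family N, F `<=` N & N `<=` D].
Proof.
move=> densD infD FD adF.
(* The condition concerns the union with [F], rather than asking [N] to contain [F], so that it also
   holds for the union of the empty chain. *)
pose P N := ad_family (N `|` F) /\ N `<=` D.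
have [C CP Ctot|N [[adN ND] maxN]] := @Zorn_bigcup _ P.
  split; last by move=> A [N CN NA]; exact: (CP _ CN).2.
  have CFlift A : (\bigcup_(N in C) N `|` F) A ->
      F A \/ exists2 N, C N & N A by move=> [[N CN NA]|]; [right; exists N|left].
  split=> [A /CFlift[/adF.1//|[N CN NA]]|A B].
    by apply: (CP _ CN).1.1; left.
  move=> /CFlift[FA|[N CN NA]] /CFlift[FB|[N' CN' NB]].
  - exact: adF.2.
  - by apply: (CP _ CN').1.2; [right|left].
  - by apply: (CP _ CN).1.2; [left|right].
  - have [NN'|N'N] := Ctot _ _ CN CN'.
      by apply: (CP _ CN').1.2; left => //; exact: NN'.
    by apply: (CP _ CN).1.2; left => //; exact: N'N.
exists (N `|` F); split=> [|A FA|A [/ND|/FD]//]; last by right.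
apply: meets_mad_family => // X Xinf; apply: contrapT => noA.
(* An [X] almost disjoint from the whole family contains some [Y] in [D]; adding this [Y]
   contradicts maximality. *)
have [Y DY YX] := densD _ Xinf; have Yinf := infD _ DY.
have NFY A : (N `|` F) A -> finite_set (A `&` Y).
  move=> NFA; apply: contrapT => AYinf; apply: noA; exists A => //.
  by apply: sub_infinite_set AYinf => n [An /YX].
have nNY : ~ N Y.
  by move=> NY; apply: Yinf; rewrite -(setIid Y); apply: NFY; left.
apply: (maxN (Y |` N)).
  split; last by move=> NYN; apply: nNY; apply: NYN; left.
  by move=> A; right.
split; last by move=> A [->|/ND].
by rewrite -setUA; apply: ad_family_setU1 => // A /NFY.
Qed.

End MadFamilies.

(** * Well orders and transfinite recursion *)

Section WellOrder.
Variables (T : Type) (le : rel T).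
Hypothesis wo_le : well_order le.
Local Notation lt y x := (init_segment le x y).

Lemma well_order_minimum (P : T -> Prop) : (exists x, P x) ->
  exists2 x, P x & forall y, P y -> le x y.
Proof.
move=> [x Px]; have [|z [[/asboolW Pz zmin] _]] := wo_le (A := fun y => `[<P y>]).
  by exists x; exact/asboolP.
by exists z => // y Py; apply: zmin; exact/asboolP.
Qed.

Lemma well_order_total x y : le x y \/ le y x.
Proof.
have [|z [->|->] zmin] := @well_order_minimum (fun z => z = x \/ z = y).
- by exists x; left.
- by left; apply: zmin; right.
- by right; apply: zmin; left.
Qed.

Lemma well_order_refl x : le x x.
Proof. by case: (well_order_total x x). Qed.

Lemma well_order_anti x y : le x y -> le y x -> x = y.
Proof.
move=> xy yx.
have [|z [_ zU]] := wo_le (A := fun z => `[<z = x \/ z = y>]).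
  by exists x; apply/asboolP; left.
have zE w : w = x \/ w = y -> z = w.
  move=> wxy; apply: zU; split; first exact/asboolP.
  by move=> v /asboolW[]->; case: wxy => -> //; exact: well_order_refl.
by rewrite -(zE x (or_introl erefl)) -(zE y (or_intror erefl)).
Qed.

Lemma well_order_trans x y z : le x y -> le y z -> le x z.
Proof.
move=> xy yz.
have [|w wxyz wmin] := @well_order_minimum (fun w => [\/ w = x, w = y | w = z]).
  by exists x; constructor 1.
case: wxyz wmin => -> wmin; first by apply: wmin; constructor 3.
  by rewrite (well_order_anti xy (wmin _ (Or31 _ _ erefl))).
by rewrite -(well_order_anti yz (wmin _ (Or32 _ _ erefl))).
Qed.

Lemma ltNge x y : ~ le x y -> lt y x.
Proof.
move=> nxy; have [//|yx] := well_order_total x y.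
by split=> // yx'; apply: nxy; rewrite yx'; exact: well_order_refl.
Qed.

Lemma le_lt_trans x y z : le x y -> lt y z -> lt x z.
Proof.
move=> xy [yz nyz]; split; first exact: well_order_trans yz.
by move=> xz; apply: nyz; apply: well_order_anti => //; rewrite -xz.
Qed.

Lemma lt_wf : well_founded (fun y x => lt y x).
Proof.
move=> x; apply: contrapT => nx.
have [|z nz zmin] := @well_order_minimum (fun z => ~ Acc (fun y x => lt y x) z).
  by exists x.
apply: nz; constructor=> y [yz nyz]; apply: contrapT => /zmin zy.
by apply: nyz; exact: well_order_anti.
Qed.

(** Since [S] is a relation, the next value only has to exist, and its existence may rely on the
    correctness of all earlier choices. *)
Lemma well_order_recursion (V : Type) (v0 : V) (S : (T -> V) -> T -> V -> Prop) :
  (forall F G x v, (forall y, lt y x -> F y = G y) -> S F x v -> S G x v) ->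
  (forall F x, (forall y, lt y x -> S F y (F y)) -> exists v, S F x v) ->
  exists F, forall x, S F x (F x).
Proof.
move=> Sloc Sex.
pose ext x (f : forall y, lt y x -> V) y :=
  if pselect (lt y x) is left yx then f y yx else v0.
(* The default [v0] makes [R] total; the final induction shows that [F] never falls back on it. *)
pose R x (f : forall y, lt y x -> V) :=
  if pselect (exists v, S (ext x f) x v) is left h then projT1 (cid h) else v0.
pose F := Fix lt_wf (fun=> V) R.
have FE x : F x = R x (fun y _ => F y).
  apply: (Fix_eq lt_wf (fun=> V) R) => {}x f g fg; congr R.
  by apply: functional_extensionality_dep => y; apply: funext => yx.
have extF x y : lt y x -> ext x (fun y _ => F y) y = F y.
  by rewrite /ext; case: pselect.
exists F => x; elim: x / (lt_wf x) => x _ IH.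
have [v Sv] := Sex F x IH.
apply: (Sloc (ext x (fun y _ => F y))); first exact: extF.
rewrite FE /R; case: pselect => [h|[]]; first exact: projT2 (cid h).
by exists v; apply: Sloc Sv => y /extF.
Qed.

End WellOrder.

(** * Branches of the binary tree, stored with the latest digit first *)

Fixpoint branch (f : nat -> bool) n : seq bool :=
  if n is k.+1 then f k :: branch f k else [::].

Lemma branch_split (f g : nat -> bool) : f <> g ->
  exists2 n, branch f n = branch g n & f n <> g n.
Proof.
move=> fg; have ex : exists n, f n != g n.
  apply: contrapT => nex; apply: fg; apply: funext => n.
  by apply/eqP; apply: contrapT => /negP ?; apply: nex; exists n.
case: (ex_minnP ex) => n /eqP nE nmin; exists n => //.
have : forall k, k <= n -> branch f k = branch g k; last exact.
elim=> [//|k IH] kn /=; rewrite IH 1?ltnW //; congr cons.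
by apply/eqP; apply: contraLR kn => /nmin; rewrite -leqNgt.
Qed.

(** * Stages of the construction and density of the admissible sets *)

Section Construction.
Variables (T : Type) (le : rel T).
Hypothesis wo_le : well_order le.
Local Notation lt y x := (init_segment le x y).
Implicit Types (F M : T -> set (set nat)) (x y z : T) (A B U X Y Z : set nat).

Definition below F x : set (set nat) :=
  [set Y | infinite_set Y /\
           forall y, lt y x -> exists2 A, F y A & almost_subset Y A].

(** If [x] is the successor of [p], this is [F p]; at a limit it consists of the sets that
    eventually stay in the families. *)
Definition persistent F x : set (set nat) :=
  [set A | exists2 y, lt y x & forall z, le y z -> lt z x -> F z A].

(* At stage [x] at most one persistent set, called [U], is given up. *)
Definition matrix_step (E : T -> set nat) F x (N : set (set nat)) : Prop :=
  [/\ mad_family N, N `<=` below F x, exists2 A, N A & A `<=` E x &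
      exists U, persistent F x `\ U `<=` N].

Lemma matrix_step_local E F G x N : (forall y, lt y x -> F y = G y) ->
  matrix_step E F x N -> matrix_step E G x N.
Proof.
move=> FG [madN Nbelow NE [U UN]]; split=> //.
  move=> Y /Nbelow[Yinf YF]; split=> // y yx; rewrite -FG //; exact: YF.
exists U => A [[y yx Ay] AU]; apply: UN; split=> //.
by exists y => // z yz zx; rewrite FG //; exact: Ay.
Qed.

Lemma below_sub F x Y Z : below F x Y -> infinite_set Z -> almost_subset Z Y ->
  below F x Z.
Proof.
move=> [_ Ybelow] Zinf ZY; split=> // y /Ybelow[A FA YA].
by exists A => //; exact: almost_subset_trans YA.
Qed.

Section Density.
Variables (F : T -> set (set nat)) (x : T) (U : T -> set nat).
Hypothesis F_mad : forall y, lt y x -> mad_family (F y).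
Hypothesis F_below : forall y, lt y x -> F y `<=` below F y.
Hypothesis F_persistent :
  forall y, lt y x -> persistent F y `\ (U y) `<=` F y.
Hypothesis card_lt : ~ ([set: nat -> bool] #<= init_segment le x).

Lemma below_le y z A : le y z -> lt z x -> F z A ->
  exists2 B, F y B & almost_subset A B.
Proof.
move=> yz zx FA; have [yz'|yz'] := pselect (y = z).
  by exists A; [rewrite yz'|exact: subset_almost].
by have [_] := F_below zx FA; apply.
Qed.

(** Intersecting [X] successively with members of the families [F (s n)] gives a decreasing
    sequence, any pseudo-intersection of which is almost contained in a member of each earlier
    family. *)
Lemma below_dense_countable_cofinality (s : nat -> T) X :
  (forall n, lt (s n) x) -> (forall y, lt y x -> exists n, le y (s n)) ->
  infinite_set X -> exists2 Y, below F x Y & Y `<=` X.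
Proof.
move=> sx scof Xinf.
have /choice[h hP] (p : nat * set nat) : exists A, infinite_set p.2 ->
    F (s p.1) A /\ infinite_set (p.2 `&` A).
  have [pinf|] := pselect (infinite_set p.2); last by exists set0.
  by have [A FA pA] := mad_family_meets (F_mad (sx p.1)) pinf; exists A.
pose Y := fix Y n := if n is k.+1 then Y k `&` h (k, Y k) else X.
have Yinf n : infinite_set (Y n).
  by elim: n => [//|n IH]; exact: (hP (n, Y n) IH).2.
have [Z Zinf [ZX ZY]] := pseudo_intersection Yinf (fun n => @subIsetl _ _ _).
exists Z => //; split=> // y /scof[n yn].
have [B FB hB] := below_le yn (sx n) (hP (n, Y n) (Yinf n)).1.
exists B => //; apply: almost_subset_trans hB.
by apply: almost_subset_trans (ZY n.+1) _; exact: almost_subIsetr.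
Qed.

(** By induction: having stayed in all families from [a] up to [y], the set [A] is persistent at
    [y], where only [U y] can be lost. *)
Lemma unchanged_persists a A : lt a x -> F a A ->
  (forall y, lt y x -> A <> U y) -> forall y, le a y -> lt y x -> F y A.
Proof.
move=> ax FA AU y; elim: y / (lt_wf wo_le y) => y _ IH ay yx.
have [<-//|nay] := pselect (a = y).
apply: F_persistent => //; split; last exact: AU.
exists a => // z az zy; apply: IH => //.
by apply: le_lt_trans yx => //; exact: zy.1.
Qed.

Lemma unchanged_below a A : lt a x -> F a A ->
  (forall y, lt y x -> A <> U y) -> below F x A.
Proof.
move=> ax FA AU; split=> [|y yx]; first exact: (F_mad ax).1.1.
have [ya|ay] := well_order_total wo_le y a; first exact: below_le FA.
by exists A; [exact: unchanged_persists FA _ _ ay yx|exact: subset_almost].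
Qed.

(** Otherwise each earlier family has just one member meeting [Y] in an infinite set, and that
    member almost contains [Y]. *)
Lemma not_below_splits Y : infinite_set Y -> ~ below F x Y ->
  exists y (A : bool -> set nat), lt y x /\
    (forall b, F y (A b) /\ infinite_set (Y `&` A b)) /\ A true <> A false.
Proof.
move=> Yinf nY; apply: contrapT => nsplit; apply: nY; split=> // y yx.
have [A FA YA] := mad_family_meets (F_mad yx) Yinf; exists A => //.
apply: (mad_family_almost_subset (F_mad yx)) => // B FB YB.
apply: contrapT => BA; apply: nsplit; exists y, (fun b => if b then B else A).
by split=> //; split=> // -[].
Qed.

(* If [X] contains no element of [below F x], then the sets below [X] split
   forever; the countably many levels at which a binary tree of such splittings
   happens are bounded by some [a] below [x], and the branches of the tree give
   continuum many members of [F a] meeting [X], too many to be all given up. *)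
Lemma below_dense X : infinite_set X -> exists2 Y, below F x Y & Y `<=` X.
Proof.
move=> Xinf; apply: contrapT => nX.
have /choice[h hP] Y : exists p : T * (bool -> set nat),
    infinite_set Y -> Y `<=` X -> [/\ lt p.1 x, (forall b, F p.1 (p.2 b)),
      (forall b, infinite_set (Y `&` p.2 b)) & p.2 true <> p.2 false].
  have splitX Z : infinite_set Z -> Z `<=` X ->
      exists y (A : bool -> set nat), lt y x /\ (forall b : bool, F y (A b) /\
        infinite_set (Z `&` A b)) /\ A true <> A false.
    move=> Zinf ZX; apply: not_below_splits => // Zbelow.
    by apply: nX; exists Z.
  have [[Yinf YX]|nY] := pselect (infinite_set Y /\ Y `<=` X).
    have [y [A [yx [FA nA]]]] := splitX Y Yinf YX.
    by exists (y, A) => _ _; split=> // b; case: (FA b).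
  (* Such a [Y] needs only a dummy value; splitting [X] supplies the index. *)
  have [y _] := splitX X Xinf (@subset_refl _ _).
  by exists (y, fun=> set0) => Yinf YX; case: nY.
pose node := fix node s :=
  if s is b :: t then node t `&` (h (node t)).2 b else X.
have nodeX s : infinite_set (node s) /\ node s `<=` X.
  elim: s => [|b s [sinf sX]]; first by split.
  by have [_ _ inf _] := hP _ sinf sX; split; [exact: inf|move=> n [/sX]].
pose level s := (h (node s)).1; pose side s := (h (node s)).2.
have [level_lt side_F side_ne] : [/\ forall s, lt (level s) x,
    forall s b, F (level s) (side s b) & forall s, side s true <> side s false].
  by split=> s; have [] := hP _ (nodeX s).1 (nodeX s).2.
(* Without such an [a] the countably many levels are cofinal below [x], and the case of countable
   cofinality applies. *)
have [a ax level_a] : exists2 a, lt a x & forall s, lt (level s) a.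
  apply: contrapT => na; apply: nX.
  apply: (@below_dense_countable_cofinality
            (fun n => level (odflt [::] (unpickle n)))) => // y yx.
  apply: contrapT => ny; apply: na; exists y => // s.
  apply: ltNge => // ys; apply: ny; exists (pickle s).
  by rewrite pickleK.
have /choice[Y YP] (f : nat -> bool) : exists Y, [/\ infinite_set Y, Y `<=` X &
    forall n, almost_subset Y (node (branch f n))].
  have [|n|Y Yinf [YX Yf]] := @pseudo_intersection (fun n => node (branch f n)).
  - by move=> n; exact: (nodeX _).1.
  - exact: subIsetl.
  - by exists Y.
have /choice[A AP] (f : nat -> bool) : exists A, F a A /\ infinite_set (Y f `&` A).
  have [Yinf _ _] := YP f.
  by have [A FA YA] := mad_family_meets (F_mad ax) Yinf; exists A.
(* [A f] remembers [f]: its infinite trace on [Y f] is almost contained in the side chosen at each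
   node of the branch, so it determines that side. *)
have A_side f n B : F (level (branch f n)) B -> almost_subset (A f) B ->
    B = side (branch f n) (f n).
  move=> FB AB; have [Yinf _ Ynode] := YP f.
  apply: (ad_family_eq (F_mad (level_lt _)).1 FB) => //.
  apply: (infinite_almost_subsetI (AP f).2).
    by apply: almost_subset_trans AB; exact: almost_subIsetr.
  apply: almost_subset_trans (almost_subIsetl _ _) _.
  apply: almost_subset_trans (Ynode n.+1) _.
  exact: almost_subIsetr.
have A_inj : injective A.
  move=> f g Afg; apply: contrapT => /branch_split[n fg fgn].
  have [B FB AB] := below_le (level_a (branch f n)).1 ax (AP f).1.
  have := A_side f n B FB AB; rewrite fg.
  rewrite (A_side g n B) -?fg -?Afg // => E.
  case: (f n) (g n) fgn E => -[] // _ E; apply: (side_ne (branch f n)).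
    by rewrite E.
  by rewrite -E.
(* If every [A f] were given up, mapping [f] to a stage where this happens would inject the branches
   into the segment below [x]. *)
have [f fU] : exists f, forall y, lt y x -> A f <> U y.
  apply: contrapT => nf; apply: card_lt.
  have /choice[u uP] f : exists y, lt y x /\ A f = U y.
    apply: contrapT => ny; apply: nf; exists f => y yx Afy.
    by apply: ny; exists y.
  have u_inj : injective u.
    by move=> f g ufg; apply: A_inj; rewrite (uP f).2 ufg -(uP g).2.
  rewrite -(card_le_eql (inj_card_eq (f := u) (in2W u_inj))).
  by apply: subset_card_le => _ [f _ <-]; exact: (uP f).1.
apply: nX; exists (Y f `&` A f); last by have [_ YX _] := YP f; move=> n [/YX].
apply: below_sub (unchanged_below ax (AP f).1 fU) (AP f).2 _.
exact: almost_subIsetr.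
Qed.

Lemma persistent_below : persistent F x `<=` below F x.
Proof.
move=> A [a ax Aa]; split=> [|y yx].
  by apply: (F_mad ax).1.1; apply: Aa => //; exact: well_order_refl.
have [ya|ay] := well_order_total wo_le y a.
  exact: below_le ya ax (Aa _ (well_order_refl wo_le _) ax).
by exists A; [exact: Aa|exact: subset_almost].
Qed.

Lemma persistent_ad : ad_family (persistent F x).
Proof.
split=> [A /persistent_below[]//|A B [a ax Aa] [b bx Bb]].
have [ab|ba] := well_order_total wo_le a b.
  by apply: (F_mad bx).1.2; [exact: Aa|apply: Bb => //; exact: well_order_refl].
by apply: (F_mad ax).1.2; [apply: Aa => //; exact: well_order_refl|exact: Bb].
Qed.

(** Giving up one set suffices: if [Y] meets a persistent [V] in an infinite set, [Y] is shrunk into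
    [V], from which all other persistent sets are almost disjoint. *)
Lemma persistent_avoid X : infinite_set X ->
  exists V Y, [/\ below F x Y, Y `<=` X &
                  forall A, (persistent F x `\ V) A -> finite_set (A `&` Y)].
Proof.
move=> /below_dense[Y Ybelow YX].
have [[V PV YV]|nV] := pselect (exists2 V, persistent F x V &
                                           infinite_set (Y `&` V)).
  exists V, (Y `&` V); split=> [|n [/YX]//|A [PA AV]].
    by apply: below_sub Ybelow YV _; exact: almost_subIsetl.
  apply: (@sub_finite_set _ _ (A `&` V)); first by move=> n [An [_ Vn]].
  exact: persistent_ad.2.
exists set0, Y; split=> // A [PA _]; apply: contrapT => AY.
by apply: nV; exists A => //; rewrite setIC.
Qed.

End Density.

Lemma matrix_step_exists E F x : infinite_set (E x) ->
  ~ ([set: nat -> bool] #<= init_segment le x) ->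
  (forall y, lt y x -> matrix_step E F y (F y)) ->
  exists N, matrix_step E F x N.
Proof.
move=> Einf card_lt stepF.
have F_mad y : lt y x -> mad_family (F y) by move=> /stepF[].
have F_below y : lt y x -> F y `<=` below F y by move=> /stepF[].
have /choice[U UP] y : exists U, lt y x -> persistent F y `\ U `<=` F y.
  have [/stepF[_ _ _ [U UF]]|] := pselect (lt y x); first by exists U.
  by exists set0.
have [V [Y [Ybelow YE VY]]] := persistent_avoid F_mad F_below UP card_lt Einf.
have adP := persistent_ad F_mad F_below.
have [||||N [madN NY Nbelow]] :=
    @extend_to_mad_family (below F x) (Y |` (persistent F x `\ V)).
- exact: below_dense F_mad F_below UP card_lt.
- by move=> Z [].
- by move=> Z [->//|[PZ _]]; exact: persistent_below PZ.
- apply: ad_family_setU1 => [|//|A PA _]; [|by case: Ybelow|exact: VY].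
  by split=> [A [/adP.1]|A B [PA _] [PB _]] //; exact: adP.2.
exists N; split=> //; first by exists Y => //; apply: NY; left.
by exists V => A PA; apply: NY; right.
Qed.

End Construction.

(** * Assembling the base matrix *)

Lemma refining_dense_base_matrix (T : Type) (le : rel T) M :
  (forall g, mad_family (M g)) ->
  (forall g d, le g d -> refines (M d) (M g)) ->
  (forall B, infinite_set B -> exists g, exists2 A, M g A & almost_subset A B) ->
  base_matrix le M.
Proof.
move=> madM refM densM; split=> //; split=> // -[F madF refF].
(* A member [B] of a common refinement is split by some [C]. Density puts a matrix set [A] almost
   inside [C], while the same family has a member almost containing [B]; the two coincide, so [B] is
   almost inside [C]. *)
have [B FB Binf] := mad_family_meets madF infinite_nat.
rewrite setTI in Binf.
have [C CB [Cinf BCinf]] := infinite_coinfinite_subset Binf.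
have [g [A MA AC]] := densM _ Cinf.
have [A' MA' BA'] := refF g _ FB.
have Ainf := (madM g).1.1 _ MA.
have AA' : A = A'.
  apply: (ad_family_eq (madM g).1) => //.
  apply: infinite_almost_subsetI Ainf (subset_almost (@subset_refl _ _)) _.
  apply: almost_subset_trans AC (almost_subset_trans (subset_almost CB) BA').
by apply: BCinf; apply: almost_subset_trans AC; rewrite AA'.
Qed.

Theorem theoremA (T : Type) (le : rel T) :
  continuum_order le -> regular_cardinal le ->
  exists M : T -> set (set nat), base_matrix le M.
Proof.
move=> [[wo_le card_le_seg] cardT] _.
have card_seg x : ~ ([set: nat -> bool] #<= init_segment le x).
  move=> h; apply: (card_le_seg x); apply: card_le_trans h.
  rewrite (card_le_eql cardT).
  pose chi (A : set nat) n := `[<A n>].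
  have chi_inj : injective chi.
    move=> A B AB; apply: funext => n; apply: propext.
    by apply: asbool_eq_equiv; exact: (congr1 (fun c => c n) AB).
  rewrite -(card_le_eql (inj_card_eq (f := chi) (in2W chi_inj))).
  exact: card_leT.
have /pcard_eqP[e] := cardT.
(* Finite sets are replaced by all of [nat], so that every stage has an infinite set to handle. *)
pose E x := if `[<infinite_set (e x)>] then e x else [set: nat].
have Einf x : infinite_set (E x).
  by rewrite /E; case: asboolP => // _; exact: infinite_nat.
have [M MP] := well_order_recursion wo_le set0
  (@matrix_step_local _ le E)
  (fun F x => matrix_step_exists wo_le (Einf x) (card_seg x)).
exists M; apply: refining_dense_base_matrix.
- by move=> g; case: (MP g).
- move=> g d gd A MA; have [gd'|ngd] := pselect (g = d).
    by exists A; [rewrite gd'|exact: subset_almost].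
  by have [_ Mbelow _ _] := MP d; have [_] := Mbelow _ MA; apply.
- move=> B Binf; have [x _ xB] : [set e x | x in [set: T]] B.
    exact: (@surj _ _ _ _ e).
  have [_ _ [A MA AE] _] := MP x; exists x; exists A => //.
  apply: subset_almost; move: AE; rewrite /E xB.
  by case: asboolP.
Qed.
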